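(* For $n\ge1$ let $\theta_n$ be the acute angle opposite to the leg of length $\sqrt{F_n}$ in the right triangle with legs $\sqrt{F_n}$, $\sqrt{F_{n+1}}$ and hypotenuse $\sqrt{F_{n+2}}$. Then $$\lim_{n\to\infty}\theta_n=\csc^{-1}(\varphi).$$
   Context: $F_n$ denotes the $n$-th Fibonacci number: $F_1=F_2=1$ and $F_{n+1}=F_n+F_{n-1}$ for $n\ge 2$. $\varphi=(1+\sqrt5)/2$. Here $\csc^{-1}(x)$, for $x\ge 1$, is the angle $\theta\in(0,\pi/2]$ with $1/\sin\theta=x$. The triangles in question are the triangles $\Delta_n$ of the Fibonacci--Theodorus spiral, and $\theta_n$ is the angle of $\Delta_n$ at the common vertex of the spiral; for $n=1$ the two legs both have length $1$ and $\theta_1=\pi/4$. *)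

(* Defs.v *)
From HB Require Import structures.
From mathcomp Require Import all_boot all_order all_algebra.
From mathcomp Require Import all_classical all_reals all_analysis.
Set Implicit Arguments.
Unset Strict Implicit.
Unset Printing Implicit Defensive.
Import Order.TTheory GRing.Theory Num.Theory.
Import numFieldNormedType.Exports.

Local Open Scope classical_set_scope.
Local Open Scope ring_scope.

(* The value at 0 is the usual extension of F_1 = F_2 = 1 by F_0 = 0. *)
Fixpoint fib (n : nat) : nat :=
  if n is p.+1 then (if p is q.+1 then fib p + fib q else 1)%N else 0%N.

Definition golden_ratio (R : realType) : R := (1 + Num.sqrt 5) / 2.

(* Same encoding as [acos] and [asin] in trigo.v; see [acscP] for 1 <= x. *)
Definition acsc (R : realType) (x : R) : R :=
  get [set t : R | 0 < t <= pi / 2 /\ (sin t)^-1 = x].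

Lemma acscP (R : realType) (x : R) :
  1 <= x -> 0 < acsc x <= pi / 2 /\ (sin (acsc x))^-1 = x.
Proof.
move=> x1; rewrite /acsc; case: xgetP => //= /(_ (asin x^-1)) [].
have x0 : 0 < x by apply: lt_le_trans x1.
have x'0 : 0 < x^-1 by rewrite invr_gt0.
have B : -1 <= x^-1 <= 1.
  by rewrite invf_le1 // x1 (le_trans (lerN10 _)) // ltW.
have E : sin (asin x^-1) = x^-1 by rewrite asinK ?in_itv.
split; last by rewrite E invrK.
rewrite asin_lepi2 // andbT ltNge; apply/negP => a0.
have : 0 <= sin (- asin x^-1).
  apply: sin_ge0_pi; rewrite oppr_ge0 a0 lerNl /=.
  apply: le_trans (asin_geNpi2 B).
  by rewrite lerN2 ler_pdivrMr // ler_peMr ?pi_ge0 // ler1n.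
by rewrite sinN E oppr_ge0 leNgt x'0.
Qed.

(* The library's norm on row vectors is the sup norm, whence these. *)
Definition dot (R : realType) (u v : 'rV[R]_2) : R := \sum_i u 0 i * v 0 i.

Definition enorm (R : realType) (u : 'rV[R]_2) : R := Num.sqrt (dot u u).

(* The unoriented angle at the vertex Q between the rays QP and QS. *)
Definition angle (R : realType) (P Q S : 'rV[R]_2) : R :=
  acos (dot (P - Q) (S - Q) / (enorm (P - Q) * enorm (S - Q))).

(* The right angle is at C; the leg BC, of length a, is opposite to A. *)
Definition right_triangle (R : realType) (A B C : 'rV[R]_2) (a b c : R) :=
  [/\ angle A C B = pi / 2, enorm (B - C) = a, enorm (A - C) = b
    & enorm (A - B) = c].

(* Main.v *)
Require Import Defs.
From HB Require Import structures.
From mathcomp Require Import all_boot all_order all_algebra.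
From mathcomp Require Import all_classical all_reals all_analysis.
From mathcomp Require Import ring lra.
Set Implicit Arguments.
Unset Strict Implicit.
Unset Printing Implicit Defensive.
Import Order.TTheory GRing.Theory Num.Theory.
Import numFieldNormedType.Exports.
Local Open Scope classical_set_scope.
Local Open Scope ring_scope.

(* The three side lengths determine every angle of a triangle, and here
   a^2 + b^2 = c^2; hence theta_n = acos (sqrt (F_(n+1) / F_(n+2))). The ratios
   r_n = F_(n+1) / F_(n+2) satisfy r_(n+1) = 1 / (1 + r_n), a contraction of
   factor 1 / phi around its fixed point 1 / phi. Finally, an angle with sine
   1 / phi has cosine sqrt (1 - 1 / phi^2) = sqrt (1 / phi). *)

Lemma fib_gt0 n : (0 < fib n.+1)%N.
Proof. by elim: n => // n IH; rewrite [fib _]/= addn_gt0 IH. Qed.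

Lemma fibSS n : fib n.+2 = (fib n.+1 + fib n)%N.
Proof. by []. Qed.

(** The last equation is [phi ^ 2 = phi + 1] divided by [phi ^ 2]; it makes [1 / phi] the fixed
    point of [r -> 1 / (1 + r)]. *)
Lemma golden_ratioVP (R : realType) :
  [/\ 0 < (golden_ratio R)^-1, (golden_ratio R)^-1 < 1
    & (golden_ratio R)^-1 * (1 + (golden_ratio R)^-1) = 1].
Proof.
have s2 : Num.sqrt 5 ^+ 2 = 5 :> R by rewrite sqr_sqrtr.
have s1 : 1 < Num.sqrt 5 :> R by rewrite -[ltLHS]sqrtr1 ltr_sqrt //; lra.
have g1 : 1 < golden_ratio R by rewrite /golden_ratio; lra.
have gE : golden_ratio R ^+ 2 = golden_ratio R + 1 by rewrite /golden_ratio; lra.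
have g0 : golden_ratio R != 0 by rewrite gt_eqF//; lra.
split; [by rewrite invr_gt0; lra| by rewrite invf_lt1//; lra|].
apply: (mulfI (expf_neq0 2 g0)).
by rewrite mulr1 [RHS]gE; field.
Qed.

Lemma cvg_fib_ratio (R : realType) :
  (fun n => (fib n.+1)%:R / (fib n.+2)%:R : R) @ \oo --> (golden_ratio R)^-1.
Proof.
have [] := golden_ratioVP R; set x := _^-1 => x0 x1 xE.
have F0 n : 0 < (fib n.+1)%:R :> R by rewrite ltr0n fib_gt0.
(* At [n = 0] the ratio is [1], at distance [1 - x <= 1] from [x]; each further step gains a factor
   [x]. *)
have bnd n : `|(fib n.+1)%:R / (fib n.+2)%:R - x| <= x ^+ n.
  elim: n => [|n IH]; first by rewrite expr0 /= divr1 ger0_norm; lra.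
  have := F0 n; have := F0 n.+1; have := F0 n.+2; move: IH.
  rewrite (fibSS n.+1) natrD.
  set a := (fib n.+1)%:R; set b := (fib n.+2)%:R => IH c0 b0 a0.
  have -> : b / (b + a) - x = x * (b / (b + a)) * (x - a / b).
    (* Inserting [x * (1 + x) = 1] here leaves an identity valid for every [x], within reach of
       [field]. *)
    have -> : b / (b + a) - x = b / (b + a) * (x * (1 + x)) - x.
      by rewrite xE mulr1.
    by field; rewrite !gt_eqF//; lra.
  rewrite normrM distrC exprSr mulrC ler_pM//.
  have q0 : 0 <= b / (b + a) by rewrite divr_ge0//; lra.
  rewrite ger0_norm; last by rewrite mulr_ge0// ltW.
  by rewrite ler_piMr ?(ltW x0)// ler_pdivrMr; lra.
apply/subr_cvg0/norm_cvg0P.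
apply: (@squeeze_cvgr _ _ _ _ (fun=> 0) (fun n => x ^+ n)).
- by apply: nearW => n; rewrite normr_ge0 bnd.
- exact: cvg_cst.
- by apply: cvg_expr; rewrite ger0_norm// ltW.
Qed.

Lemma acsc_golden_ratio (R : realType) :
  acsc (golden_ratio R) = acos (Num.sqrt (golden_ratio R)^-1).
Proof.
have [x0 x1 xE] := golden_ratioVP R.
have g1 : 1 <= golden_ratio R by rewrite -invf_le1 ?ltW// -invr_gt0.
have [/andP[t0 tpi] st] := acscP g1.
rewrite -[LHS]cosK; last first.
  by rewrite in_itv/= ltW//= (le_trans tpi)// ler_pdivrMr// ler_peMr ?pi_ge0// ler1n.
(* The range of [acsc] makes the cosine nonnegative, so it is the positive root of [1 - sin ^ 2]. *)
congr acos; rewrite -[LHS]ger0_norm; last first.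
  by apply: cos_ge0_pihalf; rewrite tpi andbT; have := pi_ge0 R; lra.
rewrite -sqrtr_sqr cos2sin2; congr Num.sqrt.
have -> : sin (acsc (golden_ratio R)) = (golden_ratio R)^-1.
  by rewrite -[LHS]invrK st.
by rewrite -[X in X - _]xE; ring.
Qed.

Lemma enorm_sqr (R : realType) (u : 'rV[R]_2) : enorm u ^+ 2 = dot u u.
Proof. by rewrite sqr_sqrtr// sumr_ge0// => i _; rewrite -expr2 sqr_ge0. Qed.

(** Polarization: it expresses the cosine of an angle through side lengths alone. *)
Lemma dot_polar (R : realType) (u v : 'rV[R]_2) :
  dot u v = (enorm u ^+ 2 + enorm v ^+ 2 - enorm (u - v) ^+ 2) / 2.
Proof. by rewrite !enorm_sqr /dot !big_ord_recl !big_ord0 !mxE; field. Qed.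

Lemma enormB (R : realType) (u v : 'rV[R]_2) : enorm (u - v) = enorm (v - u).
Proof.
by congr Num.sqrt; apply: eq_bigr => i _; rewrite !mxE; ring.
Qed.

(** Law of cosines at [A]: since [(B - A) - (C - A) = B - C], the dot product is
    [(c ^ 2 + b ^ 2 - a ^ 2) / 2 = b ^ 2]. *)
Lemma right_triangle_angle (R : realType) (A B C : 'rV[R]_2) (a b c : R) :
  right_triangle A B C a b c -> a ^+ 2 + b ^+ 2 = c ^+ 2 -> 0 < b ->
  angle B A C = acos (b / c).
Proof.
move=> [_ ha hb hc] pyth b0.
rewrite /angle dot_polar opprB addrA subrK ha ![enorm (_ - A)]enormB hb hc -pyth.
congr acos.
have -> : (a ^+ 2 + b ^+ 2 + b ^+ 2 - a ^+ 2) / 2 = b * b by field.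
by rewrite -mulf_div divff ?gt_eqF// mulr1.
Qed.

Theorem corollary2p2 (R : realType) (A B C : nat -> 'rV[R]_2)
    (theta : nat -> R)
    (hDelta : forall n : nat, (1 <= n)%N ->
       right_triangle (A n) (B n) (C n) (Num.sqrt (fib n)%:R)
         (Num.sqrt (fib n.+1)%:R) (Num.sqrt (fib n.+2)%:R))
    (htheta : forall n : nat, (1 <= n)%N ->
       theta n = angle (B n) (A n) (C n)) :
  theta @ \oo --> acsc (golden_ratio R).
Proof.
have [x0 x1 _] := golden_ratioVP R.
have thetaE n : (1 <= n)%N ->
    acos (Num.sqrt ((fib n.+1)%:R / (fib n.+2)%:R)) = theta n.
  move=> n1; rewrite htheta// (right_triangle_angle (hDelta n n1)).
  - by rewrite sqrtrM// sqrtrV.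
  - by rewrite !sqr_sqrtr// fibSS natrD addrC.
  - by rewrite sqrtr_gt0 ltr0n fib_gt0.
rewrite acsc_golden_ratio.
(* The hypotheses leave [theta 0] free, so the formula is used only eventually. *)
have thetaE_near : \forall n \near \oo,
    acos (Num.sqrt ((fib n.+1)%:R / (fib n.+2)%:R)) = theta n.
  by exists 1%N.
apply: cvg_trans (near_eq_cvg thetaE_near) _.
apply: (@continuous_cvg _ _ _ _ _ _ acos).
  (* Continuity of [acos] is applied inside the open interval from [-1] to [1], which contains
     [sqrt (1 / phi)] because [1 / phi < 1]. *)
  apply: continuous_acos; rewrite (lt_le_trans _ (sqrtr_ge0 _)) ?ltrN10//=.
  by rewrite -sqrtr1 ltr_sqrt.
apply: (@continuous_cvg _ _ _ _ _ _ Num.sqrt); first exact: sqrt_continuous.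
exact: cvg_fib_ratio.
Qed.
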